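(* Let $D$ be an integral domain. (1) $D$ is a Prüfer $b$-multiplication domain if and only if $D$ is a Prüfer domain. (2) The following are equivalent: (i) $D$ is a $b$-Noetherian Prüfer domain; (ii) $D$ is a $b$-Dedekind domain (i.e., a $b$-Noetherian Prüfer $b$-multiplication domain); (iii) $D$ is a Dedekind domain.
   Context: Let $D$ be an integral domain with quotient field $K$. An overring of $D$ is a ring $T$ with $D\subseteq T\subseteq K$; a valuation overring is an overring which is a valuation domain. For each nonzero $D$-submodule $E$ of $K$ set $E^b:=\bigcap\{EV \mid V \text{ valuation overring of } D\}$. A quasi-$b$-ideal of $D$ is a nonzero ideal $I$ of $D$ with $I^b\cap D=I$. $D$ is $b$-Noetherian if the ascending chain condition holds on quasi-$b$-ideals of $D$; equivalently, for each nonzero ideal $I$ of $D$ there is a finitely generated ideal $F\subseteq I$ with $F^b=I^b$. $D$ is a Prüfer $b$-multiplication domain if every nonzero finitely generated ideal $F$ of $D$ is $b$-invertible, i.e. $(FF^{-1})^b=D^b$, where $F^{-1}:=\{x\in K\mid xF\subseteq D\}$. Fields are regarded as Dedekind domains. *)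

(* Defs.v *)
From HB Require Import structures.
From mathcomp Require Import all_boot all_order all_algebra.
From mathcomp Require Import boolp classical_sets.

Set Implicit Arguments.
Unset Strict Implicit.
Unset Printing Implicit Defensive.

Import GRing.Theory.

Local Open Scope ring_scope.
Local Open Scope classical_set_scope.

Section Domain.
Variable D : idomainType.
Local Notation K := {fraction D}.
Implicit Types (I J F P M : set D) (E A B T V : set K).

(* An ideal of D (possibly D itself): a D-submodule of D. *)
Definition ideal I : Prop := GRing.submod_closed (V := D^o) [in I].

Definition nonzero_ideal I : Prop := ideal I /\ I <> [set 0].

Definition fg_ideal F : Prop :=
  exists (n : nat) (g : 'I_n -> D),
    F = [set x | exists c : 'I_n -> D, x = \sum_(i < n) c i * g i].

Definition nonzero_fg_ideal F : Prop := fg_ideal F /\ F <> [set 0].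

Definition domK : set K := range (@tofrac D).
Definition idealK I : set K := @tofrac D @` I.

(* The product module of two additive subgroups of K. *)
Definition mulK A B : set K :=
  [set x | exists (n : nat) (a b : 'I_n -> K),
     [/\ forall i, A (a i), forall i, B (b i) & x = \sum_(i < n) a i * b i]].

Definition overring T : Prop := GRing.subring_closed [in T] /\ domK `<=` T.

(* K is also the quotient field of every overring of D, so an overring V is a
   valuation domain iff each nonzero x in K satisfies x \in V or x^-1 \in V. *)
Definition valuation_overring V : Prop :=
  overring V /\ (forall x : K, x != 0 -> V x \/ V x^-1).

(* E^b; only meaningful when E is a nonzero D-submodule of K. *)
Definition b_closure E : set K :=
  \bigcap_(V in [set V | valuation_overring V]) mulK E V.

Definition quasi_b_ideal I : Prop :=
  nonzero_ideal I /\ @tofrac D @^-1` (b_closure (idealK I)) = I.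

Definition acc (C : set (set D)) : Prop :=
  forall I_ : nat -> set D,
    (forall n, C (I_ n)) -> (forall n, I_ n `<=` I_ n.+1) ->
    exists N : nat, forall n : nat, (N <= n)%N -> I_ n = I_ N.

Definition b_noetherian : Prop := acc [set I | quasi_b_ideal I].

(* F^-1 = (D : F), for F an ideal of D. *)
Definition ideal_inv F : set K :=
  [set x | forall a : D, F a -> domK (x * tofrac a)].

Definition invertible F : Prop := mulK (idealK F) (ideal_inv F) = domK.

Definition b_invertible F : Prop :=
  b_closure (mulK (idealK F) (ideal_inv F)) = b_closure domK.

Definition prufer_domain : Prop :=
  forall F, nonzero_fg_ideal F -> invertible F.

Definition prufer_b_mult_domain : Prop :=
  forall F, nonzero_fg_ideal F -> b_invertible F.

Definition b_dedekind_domain : Prop := b_noetherian /\ prufer_b_mult_domain.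

Definition noetherian : Prop := acc [set I | ideal I].

Definition integrally_closed : Prop :=
  forall x : K, integralOver (@tofrac D) x -> domK x.

(* idealr_closed includes properness. *)
Definition prime_ideal P : Prop :=
  idealr_closed [in P] /\ prime_idealr_closed [in P].

Definition maximal_ideal M : Prop :=
  idealr_closed [in M] /\
  forall J, idealr_closed [in J] -> M `<=` J -> J = M.

(* The last condition is Krull dimension at most 1, so fields are included. *)
Definition dedekind_domain : Prop :=
  [/\ noetherian, integrally_closed &
      forall P, prime_ideal P -> P <> [set 0] -> maximal_ideal P].

End Domain.

Arguments b_noetherian D : clear implicits.
Arguments prufer_domain D : clear implicits.
Arguments prufer_b_mult_domain D : clear implicits.
Arguments b_dedekind_domain D : clear implicits.
Arguments noetherian D : clear implicits.
Arguments integrally_closed D : clear implicits.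
Arguments dedekind_domain D : clear implicits.

(* Main.v *)
Require Import Defs.
From mathcomp Require Import all_boot all_order all_algebra.
From mathcomp Require Import boolp classical_sets ring.

(** The b-operation only loses information that valuation overrings cannot
    see, and they see a great deal: by Chevalley's extension theorem
    ([chevalley]) every proper ideal J of D stays proper in some valuation
    overring V, so that 1 is not in JV.  Hence an ideal whose b-closure
    contains 1 is D itself.  Applied to the ideal F F^-1, this gives (1): for
    each F, b-invertible and invertible mean the same
    ([b_invertible_invertible]).

    In view of (1), part (2) compares b-Noetherian Prüfer domains with Dedekind
    domains.  Let D be Prüfer.  An element v of a valuation overring V has a
    denominator in D that is a unit of V ([prufer_denominator]).  So if x in D
    lies in IV for every V, the ideal of all s with sx in I survives in no
    valuation overring and is D; likewise for the ideal of all s with sx in D,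
    if x in K lies in every V.  The former shows that every ideal I is the trace
    of its b-closure on D ([prufer_quasi_b]), so b-Noetherian becomes
    Noetherian, and the latter that D is integrally closed
    ([prufer_integrally_closed]).

    The remaining steps rest on the determinant trick: in a Noetherian
    integrally closed domain, an element of K mapping some nonzero ideal into
    itself belongs to D ([stabilizer_integral]).  If a nonzero prime P of a
    Noetherian Prüfer domain were properly contained in a proper ideal J, then
    J^-1 would map P into P, hence lie in D, against J J^-1 = D
    ([prufer_noetherian_dim1]).  Conversely, let D be Dedekind and suppose that
    J = F F^-1 is proper.  Some y outside D satisfies yJ <= D
    ([inv_proper_ideal]); then y maps F^-1 into F^-1, which is a nonzero ideal
    up to a scalar, so y is in D, a contradiction ([dedekind_prufer]). *)

Set Implicit Arguments.
Unset Strict Implicit.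
Unset Printing Implicit Defensive.

Import GRing.Theory.

Local Open Scope ring_scope.
Local Open Scope classical_set_scope.

(** * Ideals, overrings and products of modules *)

Section Modules.
Variable D : idomainType.
Local Notation K := {fraction D}.
Local Notation "a %:F" := (@tofrac D a).
Implicit Types (I J F P M : set D) (A B T V : set K).

Lemma tofrac_inj : injective (@tofrac D).
Proof. by move=> x y /eqP; rewrite tofrac_eq => /eqP. Qed.

Lemma fracE (x : K) : exists a b : D, b != 0 /\ x = a%:F / b%:F.
Proof.
elim/quotW: x => r; exists (\n_r), (\d_r); split; first exact: denom_ratioP.
apply/(canRL (mulfK _)); first by rewrite tofrac_eq0 denom_ratioP.
rewrite /tofrac; unlock FracField.tofrac.
rewrite -[LHS]FracField.pi_mul; apply/eqmodP => /=.
rewrite FracField.equivfE /FracField.mulf /= !numden_Ratio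
  ?(oner_eq0, mul1r, mulr1, denom_ratioP) //=.
by rewrite mulrC.
Qed.

Lemma idealP I :
  ideal I <-> I 0 /\ forall a x y, I x -> I y -> I (a * x + y).
Proof.
split=> [[I0 Il]|[I0 Il]]; split.
- exact: set_mem I0.
- by move=> a x y Ix Iy; apply: set_mem (Il a _ _ (mem_set Ix) (mem_set Iy)).
- exact: mem_set.
- by move=> a x y /set_mem Ix /set_mem Iy; apply: mem_set; apply: Il.
Qed.

Lemma proper_idealP I : idealr_closed [in I] <-> ideal I /\ ~ I 1.
Proof.
rewrite idealP; split=> [[I0 I1 Il]|[[I0 Il] I1]]; split.
- split; first exact: set_mem.
  by move=> a x y Ix Iy; apply: set_mem (Il a _ _ (mem_set Ix) (mem_set Iy)).
- by move=> /mem_set; apply/negP.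
- exact: mem_set.
- by apply/negP => /set_mem.
- by move=> a x y /set_mem Ix /set_mem Iy; apply: mem_set; apply: Il.
Qed.

Section IdealTheory.
Variables (I : set D) (idI : ideal I).

Lemma ideal0 : I 0. Proof. by case/idealP: idI. Qed.

Lemma idealMD a x y : I x -> I y -> I (a * x + y).
Proof. by case/idealP: idI => _; apply. Qed.

Lemma idealM a x : I x -> I (a * x).
Proof.
by move=> Ix; rewrite -[_ * _]addr0; apply: idealMD => //; exact: ideal0.
Qed.

Lemma idealD x y : I x -> I y -> I (x + y).
Proof. by move=> Ix Iy; rewrite -[x]mul1r; exact: idealMD. Qed.

End IdealTheory.

Lemma nonzero_idealE I :
  nonzero_ideal I <-> ideal I /\ exists2 a, I a & a != 0.
Proof.
split=> -[idI]; last first.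
  move=> [a Ia a0]; split=> // I0.
  by move: Ia a0; rewrite I0 /= => ->; rewrite eqxx.
move=> I0; split=> //; apply: contrapT => nI; apply: I0.
apply/seteqP; split=> [a Ia|a ->]; last exact: ideal0.
by apply: contrapT => /eqP a0; apply: nI; exists a.
Qed.

Section OverringTheory.
Variables (T : set K) (ovT : overring T).

Lemma overring_dom a : T a%:F.
Proof. by case: ovT => _; apply; exists a. Qed.

Lemma overring1 : T 1.
Proof. by rewrite -tofrac1; exact: overring_dom. Qed.

Lemma overring0 : T 0.
Proof. by rewrite -tofrac0; exact: overring_dom. Qed.

Lemma overringM x y : T x -> T y -> T (x * y).
Proof.
case: ovT => -[_ _ TM] _ Tx Ty.
exact: set_mem (TM _ _ (mem_set Tx) (mem_set Ty)).
Qed.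

Lemma overringB x y : T x -> T y -> T (x - y).
Proof.
case: ovT => -[_ TB _] _ Tx Ty.
exact: set_mem (TB _ _ (mem_set Tx) (mem_set Ty)).
Qed.

Lemma overringD x y : T x -> T y -> T (x + y).
Proof.
move=> Tx Ty; rewrite -[y]opprK -[- y]sub0r.
by apply: overringB => //; apply: overringB => //; exact: overring0.
Qed.

Lemma overringX x n : T x -> T (x ^+ n).
Proof.
move=> Tx; elim: n => [|n IHn]; first by rewrite expr0; exact: overring1.
by rewrite exprS; exact: overringM.
Qed.

Lemma overring_sum n (f : 'I_n -> K) : (forall i, T (f i)) -> T (\sum_i f i).
Proof.
by move=> Tf; apply: (big_ind T) => //; [exact: overring0|exact: overringD].
Qed.

End OverringTheory.

Lemma overring_build T :
  (forall a, T a%:F) -> (forall x y, T x -> T y -> T (x - y)) ->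
  (forall x y, T x -> T y -> T (x * y)) -> overring T.
Proof.
move=> TD TB TM; split; last by move=> _ [a _ <-].
split; first by apply: mem_set; rewrite -tofrac1.
- by move=> x y /set_mem Tx /set_mem Ty; apply: mem_set; exact: TB.
- by move=> x y /set_mem Tx /set_mem Ty; apply: mem_set; exact: TM.
Qed.

Lemma domKP (x : K) : domK x <-> exists a : D, x = a%:F.
Proof. by split=> [[a _ <-]|[a ->]]; exists a. Qed.

Lemma overring_domK : overring (@domK D).
Proof.
apply: overring_build => [a|_ _ [a _ <-] [b _ <-]|_ _ [a _ <-] [b _ <-]].
- by exists a.
- by exists (a - b) => //; rewrite tofracB.
- by exists (a * b) => //; rewrite tofracM.
Qed.

Lemma idealKE I (a : D) : idealK I a%:F <-> I a.
Proof. by split=> [[b Ib /tofrac_inj <-]|Ia] //; exists a. Qed.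

Lemma mulK0 A B : mulK A B 0.
Proof.
by exists 0, (fun=> 0), (fun=> 0); split=> [[]|[]|] //; rewrite big_ord0.
Qed.

Lemma mulK_mem A B a b : A a -> B b -> mulK A B (a * b).
Proof.
by move=> Aa Bb; exists 1, (fun=> a), (fun=> b); split=> //; rewrite big_ord1.
Qed.

Lemma mulKD A B x y : mulK A B x -> mulK A B y -> mulK A B (x + y).
Proof.
move=> [m [a [b [Aa Bb ->]]]] [n [c [d [Ac Bd ->]]]].
exists (m + n)%N, (fun i => match split i with inl j => a j | inr j => c j end),
  (fun i => match split i with inl j => b j | inr j => d j end).
split; [by move=> i; case: split..|].
rewrite big_split_ord /=; congr (_ + _); apply: eq_bigr => i _.
  by rewrite (unsplitK (inl i)).
by rewrite (unsplitK (inr i)).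
Qed.

Lemma mulK_ind A B (S : set K) :
  S 0 -> (forall x y, S x -> S y -> S (x + y)) ->
  (forall a b, A a -> B b -> S (a * b)) -> mulK A B `<=` S.
Proof.
move=> S0 SD SM _ [n [a [b [Aa Bb ->]]]].
by apply: (big_ind S) => // i _; apply: SM.
Qed.

Lemma mulK_scaler A B c x :
  (forall b, B b -> B (c * b)) -> mulK A B x -> mulK A B (c * x).
Proof.
move=> Bc; move: x; apply: mulK_ind.
- by rewrite mulr0; exact: mulK0.
- by move=> x y; rewrite mulrDr; exact: mulKD.
- by move=> a b Aa Bb; rewrite mulrCA; apply: mulK_mem => //; exact: Bc.
Qed.

Lemma mulK_mono A B B' : B `<=` B' -> mulK A B `<=` mulK A B'.
Proof.
move=> BB'; apply: mulK_ind; [exact: mulK0|exact: mulKD|].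
by move=> a b Aa /BB'; exact: mulK_mem.
Qed.

End Modules.

(** * Chevalley's extension theorem *)

Lemma horner_scaled (E : fieldType) n (q : {poly E}) (x : E) :
  x != 0 -> (size q <= n.+1)%N ->
  x ^+ n * q.[x^-1] = \sum_(i < n.+1) q`_(n - i) * x ^+ i.
Proof.
move=> x0 sq; rewrite (horner_coef_wide _ sq) big_distrr /=.
rewrite (reindex_inj rev_ord_inj) /=; apply: eq_bigr => i _.
rewrite subSS mulrCA; congr (_ * _); rewrite exprVn -expfB_cond.
  by rewrite subKn // -ltnS.
by rewrite (negPf x0) /= leq_subr.
Qed.

Section Chevalley.
Variables (D : idomainType) (J : set D).
Local Notation K := {fraction D}.
Local Notation "a %:F" := (@tofrac D a).
Implicit Types (T V : set K).
Hypotheses (idJ : ideal J) (J1 : ~ J 1).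

Local Notation ext T := (mulK (idealK J) T).

Definition survives T := overring T /\ ~ ext T 1.

Definition adjoin T (y : K) : set K :=
  [set z | exists p : {poly K}, (forall i, T p`_i) /\ z = p.[y]].

Lemma overring_adjoin T y : overring T -> overring (adjoin T y).
Proof.
move=> ovT; apply: overring_build.
- move=> a; exists a%:F%:P; split=> [i|]; last by rewrite hornerC.
  by rewrite coefC; case: ifP => _; [exact: overring_dom|exact: overring0].
- move=> _ _ [p [Tp ->]] [q [Tq ->]]; exists (p - q); split=> [i|].
    by rewrite coefB; exact: overringB.
  by rewrite hornerD hornerN.
- move=> _ _ [p [Tp ->]] [q [Tq ->]]; exists (p * q); split=> [i|].
    by rewrite coefM; apply: overring_sum => // j; exact: overringM.
  by rewrite hornerM.
Qed.

Lemma sub_adjoin T y : overring T -> T `<=` adjoin T y.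
Proof.
move=> ovT t Tt; exists t%:P; split=> [i|]; last by rewrite hornerC.
by rewrite coefC; case: ifP => _ //; exact: overring0.
Qed.

Lemma adjoin_mem T y : overring T -> adjoin T y y.
Proof.
move=> ovT; exists 'X; split=> [i|]; last by rewrite hornerX.
by rewrite coefX; case: eqP => _; [exact: overring1|exact: overring0].
Qed.

Lemma ext_adjoin T y z :
  ext (adjoin T y) z -> exists2 p : {poly K}, forall i, ext T p`_i & p.[y] = z.
Proof.
move: z; apply: mulK_ind.
- by exists 0; [move=> i; rewrite coef0; exact: mulK0|exact: horner0].
- move=> _ _ [p pT <-] [q qT <-]; exists (p + q); last by rewrite hornerD.
  by move=> i; rewrite coefD; exact: mulKD.
- move=> a _ Ja [p [pT ->]]; exists (a *: p); last by rewrite hornerZ.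
  by move=> i; rewrite coefZ; exact: mulK_mem.
Qed.

Lemma survives_domK : survives (@domK D).
Proof.
split; [exact: overring_domK|move=> JD1; apply: J1; apply/idealKE].
rewrite tofrac1; move: JD1; apply: mulK_ind.
- by rewrite -tofrac0; apply/idealKE; exact: ideal0.
- move=> _ _ [a Ja <-] [b Jb <-]; rewrite -tofracD; apply/idealKE.
  exact: idealD.
- move=> _ _ [a Ja <-] [b _ <-]; rewrite -tofracM mulrC; apply/idealKE.
  exact: idealM.
Qed.

(** Zorn's lemma: the finitely many coefficients in an expression of 1 as an
    element of the extension of J to the union of a chain all lie in one member
    of the chain. *)
Lemma exists_maximal_survivor :
  exists2 T, survives T & forall T', survives T' -> T `<=` T' -> T' = T.
Proof.
(* The empty set is admitted because it is the union of the empty chain. *)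
pose P T := T = set0 \/ survives T.
have [F FP Ftot|T [PT Tmax]] := @Zorn_bigcup _ P.
  have [[X FX X0]|F0] := pselect (exists2 X, F X & X <> set0); last first.
    left; rewrite bigcup0 // => X FX; apply: contrapT => X0.
    by apply: F0; exists X.
  have [ovX _] : survives X by case: (FP _ FX).
  have ovF Y x : F Y -> Y x -> overring Y.
    by move=> FY Yx; case: (FP _ FY) => [Y0|[]//]; move: Yx; rewrite Y0.
  right; split.
    apply: overring_build =>
      [a|x y [Y FY Yx] [Z FZ Zy]|x y [Y FY Yx] [Z FZ Zy]].
    - by exists X => //; exact: overring_dom.
    - by case: (Ftot _ _ FY FZ) => YZ; [exists Z|exists Y] => //;
        apply: overringB => //; try apply: YZ => //; apply: ovF; eauto.
    - by case: (Ftot _ _ FY FZ) => YZ; [exists Z|exists Y] => //;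
        apply: overringM => //; try apply: YZ => //; apply: ovF; eauto.
  have extF : ext (\bigcup_(Y in F) Y) `<=` \bigcup_(Y in F) ext Y.
    apply: mulK_ind; first by exists X => //; exact: mulK0.
    - move=> x y [Y FY Yx] [Z FZ Zy].
      case: (Ftot _ _ FY FZ) => YZ; [exists Z|exists Y] => //;
        by apply: mulKD => //; apply: mulK_mono; first exact: YZ.
    - by move=> a b Ja [Y FY Yb]; exists Y => //; exact: mulK_mem.
  move=> /extF[Y FY Y1]; case: (FP _ FY) => [Y0|[_]//].
  suff : (1 : K) = 0 by move/eqP; rewrite oner_eq0.
  move: Y1; rewrite Y0; move: (1 : K); apply: mulK_ind => // x y -> ->.
  by rewrite addr0.
have TmaxP T' : survives T' -> T `<=` T' -> T' = T.
  move=> sT' TT'; apply: contrapT => T'T; apply: (Tmax T'); last by right.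
  by rewrite properEneq; split=> //; apply/eqP => /esym.
exists T => //; case: PT => // T0.
rewrite -(TmaxP _ survives_domK) ?T0; last exact: sub0set.
exact: survives_domK.
Qed.

Section MaximalSurvivor.
Variable T : set K.
Hypotheses (sT : survives T)
  (Tmax : forall T', survives T' -> T `<=` T' -> T' = T).

Let ovT : overring T := sT.1.
Let I := ext T.

Let I1 : ~ I 1 := sT.2.

Let IM t x : T t -> I x -> I (t * x).
Proof. by move=> Tt; apply: mulK_scaler => b; exact: overringM. Qed.

Let ID x y : I x -> I y -> I (x + y).
Proof. exact: mulKD. Qed.

Let I_sum n (f : 'I_n -> K) : (forall i, I (f i)) -> I (\sum_i f i).
Proof. by move=> If; apply: (big_ind I) => //; exact: mulK0. Qed.

Let I_sub x : I x -> T x.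
Proof.
move: x; apply: mulK_ind; [exact: overring0|exact: overringD|].
move=> _ b [a _ <-] Tb; apply: overringM => //; exact: overring_dom.
Qed.

(** By maximality J generates the unit ideal of the larger ring T[y]. *)
Lemma nonmember_relation y :
  ~ T y -> exists2 p : {poly K}, forall i, I p`_i & p.[y] = 1.
Proof.
move=> Ty; apply: ext_adjoin; apply: contrapT => nT1; apply: Ty.
rewrite -(Tmax (T' := adjoin T y)); first exact: adjoin_mem.
  by split=> //; exact: overring_adjoin.
exact: sub_adjoin.
Qed.

(** JT lies in the Jacobson radical of T: were 1 - b not invertible in T, the
    relation for its inverse, cleared of denominators, would put a power of
    1 - b in JT, and 1 - b is congruent to 1 modulo JT. *)
Lemma unit_1subI b : I b -> T (1 - b)^-1.
Proof.
move=> Ib; apply: contrapT => /nonmember_relation[p pI p1].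
have b1 : 1 - b != 0.
  by apply/eqP => /eqP; rewrite subr_eq0 => /eqP b1; apply: I1; rewrite b1.
have T1b : T (1 - b).
  by apply: overringB => //; [exact: overring1|exact: I_sub].
(* Multiply the relation p.[1 / (1 - b)] = 1 by (1 - b) ^+ size p. *)
have := horner_scaled b1 (leqnSn (size p)); rewrite p1 mulr1 => E.
have {E} : I ((1 - b) ^+ size p).
  rewrite E; apply: I_sum => i; rewrite mulrC; apply: IM => //.
  exact: overringX.
elim: (size p) => [|n IHn]; first by rewrite expr0.
move=> In; apply: IHn.
rewrite [X in I X](_ : _ = (1 - b) ^+ n.+1 + (1 - b) ^+ n * b).
  by apply: ID => //; apply: IM => //; exact: overringX.
by rewrite exprSr -mulrDr subrK mulr1.
Qed.

Definition relation n (x : K) :=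
  exists p : {poly K}, [/\ (size p <= n)%N, forall i, I p`_i & p.[x] = 1].

(** A relation for 1/x, whose constant term q_0 makes 1 - q_0 a unit of T,
    expresses x^n through lower powers of x with coefficients in JT;
    substituting this for the top monomial shortens the relation for x. *)
Lemma relation_reduce n m x :
  x != 0 -> (m <= n.+1)%N -> relation n.+1 x -> relation m x^-1 -> relation n x.
Proof.
move=> x0 mn [p [sp Ip p1]] [q [sq Iq q1]].
pose c := (1 - q`_0)^-1.
have Tc : T c by exact: unit_1subI.
have q0 : 1 - q`_0 != 0.
  by apply/eqP => /eqP; rewrite subr_eq0 => /eqP qE; apply: I1; rewrite qE.
have xn : x ^+ n = \sum_(i < n) c * q`_(n - i) * x ^+ i.
  have := horner_scaled x0 (leq_trans sq mn); rewrite q1 mulr1.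
  rewrite big_ord_recr /= subnn => E.
  apply: (mulfI q0); rewrite mulrBl mul1r {1}E addrK big_distrr /=.
  by apply: eq_bigr => i _; rewrite !mulrA divff // mul1r.
exists (\poly_(i < n) (p`_i + p`_n * (c * q`_(n - i)))); split.
- exact: size_poly.
- move=> i; rewrite coef_poly; case: ifP => _; last exact: mulK0.
  by apply: ID => //; apply: IM; [exact: I_sub|exact: IM].
rewrite horner_poly -[RHS]p1 (horner_coef_wide _ sp) big_ord_recr /= xn.
rewrite big_distrr -big_split /=; apply: eq_bigr => i _.
by rewrite mulrDl -!mulrA.
Qed.

(** Infinite descent on the total length: the longer of the two relations can
    always be shortened by means of the other one, the roles of x and 1/x being
    symmetric. *)
Lemma no_two_relations N n m x :
  x != 0 -> (n + m <= N)%N -> relation n x -> relation m x^-1 -> False.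
Proof.
have no0 y : ~ relation 0 y.
  move=> [p [+ _]]; rewrite leqn0 size_poly_eq0 => /eqP ->.
  by rewrite horner0 => /esym/eqP; rewrite oner_eq0.
elim: N n m x => [|N IHN] n m x x0.
  by rewrite leqn0 addn_eq0 => /andP[/eqP-> _] /no0.
wlog mn : n m x x0 / (m <= n)%N.
  move=> W nm Rn Rm; have [mn|/ltnW nm'] := leqP m n; first exact: (W n m x).
  by apply: (W m n x^-1); rewrite ?invr_eq0 ?invrK // addnC.
case: n mn => [|n] mn; first by move=> _ /no0.
rewrite addSn ltnS => nm Rn Rm; apply: (IHN n m x) => //.
exact: relation_reduce Rm.
Qed.

Lemma maximal_survivor_valuation : valuation_overring T.
Proof.
split=> // x x0; apply: contrapT => /not_orP[].
move=> /nonmember_relation[p pI p1] /nonmember_relation[q qI q1].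
by apply: (@no_two_relations (size p + size q) (size p) (size q) x) => //;
  [exists p|exists q].
Qed.

End MaximalSurvivor.

(** A maximal overring in which J survives is a valuation ring, since otherwise
    some x and 1/x would both satisfy relations with coefficients in JT. *)
Theorem chevalley : exists2 V, valuation_overring V & ~ mulK (idealK J) V 1.
Proof.
have [T sT Tmax] := exists_maximal_survivor; exists T; last by case: sT.
exact: maximal_survivor_valuation.
Qed.

End Chevalley.

(** * Invertibility and b-invertibility *)

Section BOperation.
Variable D : idomainType.
Local Notation K := {fraction D}.
Local Notation "a %:F" := (@tofrac D a).
Implicit Types (I J F P M : set D) (A B T V : set K).

(** F F^-1 viewed as an ideal of D rather than as a submodule of K. *)
Definition inv_prod F : set D := [set d | mulK (idealK F) (ideal_inv F) d%:F].

Lemma mulK_inv_domK F : mulK (idealK F) (ideal_inv F) `<=` @domK D.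
Proof.
apply: mulK_ind.
- exact: overring0 (overring_domK D).
- exact: overringD (overring_domK D).
- by move=> _ z [a Fa <-] Fz; rewrite mulrC; exact: Fz.
Qed.

Lemma ideal_inv_scale F a z : ideal_inv F z -> ideal_inv F (a%:F * z).
Proof.
move=> Fz b Fb; rewrite -mulrA; apply: overringM; last exact: Fz.
  exact: overring_domK.
by exists a.
Qed.

Lemma ideal_invD F y z : ideal_inv F y -> ideal_inv F z -> ideal_inv F (y + z).
Proof.
move=> Fy Fz b Fb; rewrite mulrDl; apply: overringD; [|exact: Fy|exact: Fz].
exact: overring_domK.
Qed.

Lemma ideal_inv_prod F : ideal (inv_prod F).
Proof.
apply/idealP; split; first by rewrite /inv_prod /= tofrac0; exact: mulK0.
move=> a x y Fx Fy; rewrite /inv_prod /= tofracD tofracM; apply: mulKD => //.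
by apply: mulK_scaler => // z; exact: ideal_inv_scale.
Qed.

Lemma idealK_inv_prod F :
  idealK (inv_prod F) = mulK (idealK F) (ideal_inv F).
Proof.
apply/seteqP; split=> [_ [d Fd <-]//|x Fx].
by have /domKP[d dE] := mulK_inv_domK Fx; exists d; rewrite // /inv_prod /= -dE.
Qed.

Lemma invertible_inv_prod F : invertible F <-> inv_prod F 1.
Proof.
rewrite /inv_prod /invertible /= tofrac1; split=> [->|F1].
  exact: overring1 (overring_domK D).
apply/seteqP; split=> [|_ [d _ <-]]; first exact: mulK_inv_domK.
rewrite -[d%:F]mulr1; apply: mulK_scaler => // z; exact: ideal_inv_scale.
Qed.

(** Were F F^-1 proper, it would survive in a valuation overring V, whereas the
    b-closure of F F^-1 contains 1 and is contained in F F^-1 V. *)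
Lemma b_invertible_invertible F : b_invertible F <-> invertible F.
Proof.
split=> [bF|iF]; last by rewrite /b_invertible iF.
apply/invertible_inv_prod; apply: contrapT => F1.
have [V vV] := chevalley (ideal_inv_prod F) F1; rewrite idealK_inv_prod; apply.
have [ovV _] := vV.
have : b_closure (@domK D) 1.
  move=> W [ovW _]; rewrite -[1]mulr1; apply: mulK_mem; last exact: overring1.
  exact: overring1 (overring_domK D).
by rewrite -bF; apply.
Qed.

Lemma prufer_b_mult_domainE : prufer_b_mult_domain D <-> prufer_domain D.
Proof.
by split=> H F fgF; apply/b_invertible_invertible; exact: H.
Qed.

(** * Valuation overrings of Prüfer domains *)

(** In a finite sum each term is absorbed by another one, since of two elements
    of K one divides the other in V. *)
Lemma mulK_valuation V A x :
  valuation_overring V -> A 0 -> mulK A V x ->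
  exists a v, [/\ A a, V v & x = a * v].
Proof.
move=> [ovV vV] A0; move: x; apply: mulK_ind.
- by exists 0, 0; split=> //; [exact: overring0|rewrite mul0r].
- move=> _ _ [a [v [Aa Vv ->]]] [b [w [Ab Vw ->]]].
  have [->|b0] := eqVneq b 0; first by exists a, v; rewrite mul0r addr0.
  have [->|a0] := eqVneq a 0; first by exists b, w; rewrite mul0r add0r.
  have [Vab|] := vV (a / b) (mulf_neq0 a0 (invr_neq0 b0)).
    exists b, (a / b * v + w); split=> //; last first.
      by rewrite mulrDr mulrA (mulrC b (a / b)) divfK.
    by apply: overringD => //; exact: overringM.
  rewrite invf_div => Vba; exists a, (v + b / a * w); split=> //; last first.
    by rewrite mulrDr mulrA (mulrC a (b / a)) divfK.
  by apply: overringD => //; exact: overringM.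
- by move=> a v Aa Vv; exists a, v.
Qed.

(** The invertibility of the ideal (a, b). *)
Lemma prufer_bezout (a b : D) : prufer_domain D -> b != 0 ->
  exists y z : K, [/\ domK (y * a%:F), domK (y * b%:F), domK (z * a%:F),
    domK (z * b%:F) & a%:F * y + b%:F * z = 1].
Proof.
move=> prD b0.
pose g (i : 'I_2) := if i == ord0 then a else b.
pose F := [set x | exists c : 'I_2 -> D, x = \sum_(i < 2) c i * g i].
have FE x : F x <-> exists c d, x = c * a + d * b.
  split=> [[c ->]|[c [d ->]]].
    exists (c ord0), (c (lift ord0 ord0)).
    by rewrite !big_ord_recl big_ord0 addr0.
  exists (fun i => if i == ord0 then c else d).
  by rewrite !big_ord_recl big_ord0 addr0.
have Fa : F a by apply/FE; exists 1, 0; rewrite mul1r mul0r addr0.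
have Fb : F b by apply/FE; exists 0, 1; rewrite mul1r mul0r add0r.
have : inv_prod F 1.
  apply/invertible_inv_prod; apply: prD; split; first by exists 2, g.
  by move=> F0; move: Fb b0; rewrite F0 /= => ->; rewrite eqxx.
rewrite /inv_prod /= tofrac1 => F1.
suff [y [z [Fy Fz E]]] : exists y z,
    [/\ ideal_inv F y, ideal_inv F z & 1 = a%:F * y + b%:F * z].
  by exists y, z; split; [exact: Fy|exact: Fy|exact: Fz|exact: Fz|].
have Finv0 : ideal_inv F 0.
  by move=> c _; rewrite mul0r; exact: overring0 (overring_domK D).
move: F1; move: 1; apply: mulK_ind.
- by exists 0, 0; rewrite !mulr0 addr0.
- move=> _ _ [y [z [Fy Fz ->]]] [y' [z' [Fy' Fz' ->]]].
  exists (y + y'), (z + z'); split; [exact: ideal_invD..|].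
  by rewrite !mulrDr addrACA.
- move=> _ w [_ /FE[c [d ->]] <-] Fw; exists (c%:F * w), (d%:F * w).
  split; [exact: ideal_inv_scale..|].
  by rewrite tofracD !tofracM mulrDl -!mulrA (mulrCA c%:F) (mulrCA d%:F).
Qed.

(** Write v = a / b and let y, z be as in [prufer_bezout].  Then s1 = yb and
    s2 = zb are denominators of v with v s1 + s2 = 1.  Whichever of s1 and s2
    divides the other in V divides 1 there, so it is a unit of V. *)
Lemma prufer_denominator V v :
  prufer_domain D -> valuation_overring V -> V v ->
  exists s : D, [/\ s != 0, V (s%:F^-1) & domK (v * s%:F)].
Proof.
move=> prD [ovV vV] Vv; have [a [b [b0 vE]]] := fracE v.
have bF0 : b%:F != 0 by rewrite tofrac_eq0.
have [y [z [/domKP[t1 ya] /domKP[s1 yb] /domKP[t2 za] /domKP[s2 zb] E]]] :=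
  prufer_bezout a prD b0.
have vs1 : v * s1%:F = t1%:F by rewrite vE -yb -ya mulrCA divfK.
have vs2 : v * s2%:F = t2%:F by rewrite vE -zb -za mulrCA divfK.
have {}E : v * s1%:F + s2%:F = 1 by rewrite vs1 -ya -zb (mulrC y) (mulrC z).
have good s t : v * s%:F = t%:F -> s != 0 -> V (s%:F^-1) ->
    exists s : D, [/\ s != 0, V (s%:F^-1) & domK (v * s%:F)].
  by move=> vs s0 Vs; exists s; split=> //; rewrite vs; exists t.
have [s20|s20] := eqVneq s2 0.
  have {}E : v * s1%:F = 1 by rewrite -E s20 tofrac0 addr0.
  have s10 : s1%:F != 0.
    by apply/eqP => s10; move/eqP: E; rewrite s10 mulr0 eq_sym oner_eq0.
  apply: good vs1 _ _; first by rewrite -tofrac_eq0.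
  by rewrite -[_^-1]mul1r -E mulfK.
have s2F : s2%:F != 0 by rewrite tofrac_eq0.
have [s10|s10] := eqVneq s1 0.
  apply: good vs2 _ _ => //.
  have -> : s2%:F = 1 by rewrite -E s10 tofrac0 mulr0 add0r.
  by rewrite invr1; exact: overring1.
have s1F : s1%:F != 0 by rewrite tofrac_eq0.
have [Vs|] := vV (s1%:F / s2%:F) (mulf_neq0 s1F (invr_neq0 s2F)).
  apply: good vs2 _ _ => //.
  have -> : s2%:F^-1 = v * (s1%:F / s2%:F) + 1.
    by rewrite -[LHS]mul1r -{1}E mulrDl divff // mulrA.
  by apply: overringD => //; [exact: overringM|exact: overring1].
rewrite invf_div => Vs; apply: good vs1 _ _ => //.
have -> : s1%:F^-1 = v + s2%:F / s1%:F.
  by rewrite -[LHS]mul1r -{1}E mulrDl mulfK.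
exact: overringD.
Qed.

(** For x in the b-closure of I, the ideal of all s with sx in I survives in no
    valuation overring V: writing x = iv with i in I and v in V, it contains a
    denominator of v that is a unit of V. *)
Lemma prufer_quasi_b I :
  prufer_domain D -> ideal I -> @tofrac D @^-1` (b_closure (idealK I)) = I.
Proof.
move=> prD idI; apply/seteqP; split=> [x Ix|x Ix V [ovV _]]; last first.
  rewrite -[x%:F]mulr1; apply: mulK_mem; [by apply/idealKE|exact: overring1].
pose J := [set s | I (s * x)].
have idJ : ideal J.
  apply/idealP; rewrite /J /= mul0r; split; first exact: ideal0.
  by move=> a s t Is It; rewrite mulrDl -mulrA; exact: idealMD.
apply: contrapT => nIx.
have [|V vV] := chevalley idJ; first by rewrite /J /= mul1r.
apply; have [] := @mulK_valuation V (idealK I) x%:F => //.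
- by rewrite -tofrac0; apply/idealKE; exact: ideal0.
- exact: Ix.
move=> _ [v [[i Ii <-] Vv xE]].
have [s [s0 Vs /domKP[t tE]]] := prufer_denominator prD vV Vv.
rewrite -(@divff _ s%:F) ?tofrac_eq0 //; apply: mulK_mem => //.
apply/idealKE; rewrite /J /= (_ : s * x = t * i); first exact: idealM.
by apply: tofrac_inj; rewrite !tofracM xE -tE mulrCA mulrC (mulrC s%:F).
Qed.

(** If 1/x is in V, dividing an integral equation of degree n + 1 by x^n
    expresses x as a polynomial in 1/x over D. *)
Lemma valuation_integrally_closed V (x : K) :
  valuation_overring V -> integralOver (@tofrac D) x -> V x.
Proof.
move=> [ovV vV] [p mon_p /rootP].
have [->|x0] := eqVneq x 0; first by move=> _; exact: overring0.
have [//|Vx'] := vV x x0.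
have sp : size p = (size p).-1.+1 by rewrite prednK // size_poly_gt0 monic_neq0.
move: (size p).-1 sp => n sp.
rewrite horner_coef size_map_poly_id0; last first.
  by rewrite tofrac_eq0 lead_coef_eq0 monic_neq0.
rewrite sp big_ord_recr /= coef_map /=.
have -> : p`_n = 1 by move/monicP: mon_p; rewrite /lead_coef sp.
rewrite tofrac1 mul1r.
case: n sp => [|n] sp.
  by rewrite big_ord0 add0r => /eqP; rewrite oner_eq0.
move=> /eqP; rewrite addrC addr_eq0 => /eqP xE.
have -> : x = - \sum_(i < n.+1) (p`_i)%:F * x^-1 ^+ (n - i).
  apply: (mulfI (expf_neq0 n x0)); rewrite -exprSr xE mulrN big_distrr /=.
  congr (- _); apply: eq_bigr => i _; rewrite coef_map /= mulrCA.
  congr (_ * _); rewrite exprVn -expfB_cond ?(negPf x0) ?leq_subr //.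
  by rewrite subKn // -ltnS.
rewrite -[- _]sub0r; apply: overringB => //; first exact: overring0.
apply: overring_sum => // i; apply: overringM => //; first exact: overring_dom.
exact: overringX.
Qed.

(** The ideal of denominators of an integral element survives in no valuation
    overring, as each of them contains the element. *)
Lemma prufer_integrally_closed : prufer_domain D -> integrally_closed D.
Proof.
move=> prD x intx.
pose J := [set s : D | domK (x * s%:F)].
have ovD := overring_domK D.
have idJ : ideal J.
  apply/idealP; rewrite /J /= tofrac0 mulr0; split; first exact: overring0.
  move=> a s t xs xt; rewrite tofracD tofracM mulrDr mulrCA.
  by apply: overringD => //; apply: overringM => //; exists a.
apply: contrapT => nDx.
have [|V vV] := chevalley idJ; first by rewrite /J /= tofrac1 mulr1.
apply; have Vx := valuation_integrally_closed vV intx.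
have [s [s0 Vs Js]] := prufer_denominator prD vV Vx.
rewrite -(@divff _ s%:F) ?tofrac_eq0 //; apply: mulK_mem => //.
by apply/idealKE.
Qed.

(** Quasi-b-ideals are nonzero, so a chain of ideals is followed from one of its
    nonzero terms on. *)
Lemma b_noetherian_prufer_noetherian :
  b_noetherian D -> prufer_domain D -> noetherian D.
Proof.
move=> bnD prD I_ idI incI.
have [[n0 nz]|z] := pselect (exists n, I_ n <> [set 0]); last first.
  exists 0%N => n _; apply: contrapT => In0.
  have I0 m : I_ m = [set 0] by apply: contrapT => Im; apply: z; exists m.
  by apply: In0; rewrite !I0.
have inc m n : (m <= n)%N -> I_ m `<=` I_ n.
  move=> /subnK <-; elim: (n - m)%N => [//|k IHk]; rewrite addSn.
  exact: subset_trans (incI _).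
have nzI n : nonzero_ideal (I_ (n0 + n)%N).
  apply/nonzero_idealE; split; first exact: idI.
  have /nonzero_idealE[_ [a Ia a0]] : nonzero_ideal (I_ n0).
    by split=> //; exact: idI.
  by exists a => //; apply: inc Ia; exact: leq_addr.
have [n|n|N HN] := bnD (fun n => I_ (n0 + n)%N).
- by split; [exact: nzI|apply: prufer_quasi_b => //; exact: idI].
- by rewrite addnS.
exists (n0 + N)%N => n Nn.
have n0n : (n0 <= n)%N := leq_trans (leq_addr _ _) Nn.
by rewrite -(subnKC n0n) HN // leq_subRL.
Qed.

(** * Noetherian domains *)

Lemma noetherian_maximal (C : set (set D)) (I0 : set D) :
  noetherian D -> C `<=` [set I | ideal I] -> C I0 ->
  exists2 I, C I & forall J, C J -> I `<=` J -> J = I.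
Proof.
move=> noeD Cid CI0; apply: contrapT => nomax.
have next (I : {I | C I}) : {J : {J | C J} | sval I `<` sval J}.
  apply: cid; apply: contrapT => nJ; apply: nomax; exists (sval I).
    exact: svalP.
  move=> J CJ IJ; apply: contrapT => JI; apply: nJ; exists (exist _ J CJ) => /=.
  by rewrite properEneq; split=> //; apply/eqP => /esym.
pose I_ n := iter n (fun X => sval (next X)) (exist _ I0 CI0).
have I_lt n : sval (I_ n) `<` sval (I_ n.+1) by exact: svalP (next (I_ n)).
have [n|n|N HN] := noeD (fun n => sval (I_ n)).
- by apply: Cid; exact: svalP.
- exact: properW.
- by have := I_lt N; rewrite (HN N.+1) // => /properxx.
Qed.

Lemma noetherian_fg I : noetherian D -> ideal I -> fg_ideal I.
Proof.
move=> noeD idI.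
have [||F [fgF FI] Fmax] :=
  @noetherian_maximal [set F | fg_ideal F /\ F `<=` I] [set 0] noeD.
- move=> F [[n [g ->]] _] /=; apply/idealP; split.
    by exists (fun=> 0); rewrite big1 // => i _; rewrite mul0r.
  move=> a _ _ [c ->] [d ->]; exists (fun i => a * c i + d i).
  rewrite big_distrr -big_split /=; apply: eq_bigr => i _.
  by rewrite mulrDl mulrA.
- split; last by move=> _ ->; exact: ideal0.
  exists 0%N, (fun=> 0); apply/seteqP; split=> [_ ->|_ [c ->]].
    by exists (fun=> 0); rewrite big_ord0.
  by rewrite big_ord0.
suff -> : I = F by [].
apply/seteqP; split=> // x Ix.
have [n [g FE]] := fgF.
pose g' (i : 'I_n.+1) := if unlift ord0 i is Some j then g j else x.
pose F' := [set y | exists c : 'I_n.+1 -> D, y = \sum_i c i * g' i].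
have F'E y : F' y <-> exists a b, F b /\ y = a * x + b.
  split=> [[c ->]|[a [b [Fb ->]]]].
    rewrite big_ord_recl /g' unlift_none.
    exists (c ord0), (\sum_i c (lift ord0 i) * g i); split.
      by rewrite FE; exists (fun i => c (lift ord0 i)).
    by congr (_ + _); apply: eq_bigr => i _; rewrite liftK.
  move: Fb; rewrite FE => -[c ->].
  exists (fun i => if unlift ord0 i is Some j then c j else a).
  rewrite big_ord_recl /g' unlift_none; congr (_ + _).
  by apply: eq_bigr => i _; rewrite liftK.
have F0 : F 0.
  by rewrite FE; exists (fun=> 0); rewrite big1 // => i _; rewrite mul0r.
rewrite -(Fmax F') /=.
- by apply/F'E; exists 1, 0; rewrite mul1r addr0.
- split; first by exists n.+1, g'.
  move=> _ /F'E[a [b [Fb ->]]]; apply: idealD => //; last exact: FI.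
  exact: idealM.
- by move=> y Fy; apply/F'E; exists 0, y; rewrite mul0r add0r.
Qed.

(** The determinant trick: if g_1, ..., g_n generate I, the row of the g_i is an
    eigenvector with eigenvalue y of a matrix over D, so y is a root of the
    characteristic polynomial of that matrix. *)
Lemma stabilizer_integral I (y : K) :
  noetherian D -> integrally_closed D -> nonzero_ideal I ->
  (forall a, I a -> idealK I (y * a%:F)) -> domK y.
Proof.
move=> noeD icD /nonzero_idealE[idI [a0 Ia0 a00]] yI.
have [n [g IE]] := noetherian_fg noeD idI.
have Ig i : I (g i).
  rewrite IE; exists (fun j => (i == j)%:R).
  rewrite (bigD1 i) //= eqxx mul1r big1 ?addr0 // => j ji.
  by rewrite eq_sym (negPf ji) mul0r.
have /choice[c cE] i :
    exists c : 'I_n -> D, y * (g i)%:F = \sum_j (c j * g j)%:F.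
  have [b + <-] := yI _ (Ig i); rewrite IE => -[c ->].
  by exists c; rewrite rmorph_sum.
pose A : 'M[D]_n := \matrix_(j, i) c i j.
apply: icD; exists (char_poly A); first exact: char_poly_monic.
rewrite map_char_poly -eigenvalue_root_char; apply/eigenvalueP.
exists (\row_i (g i)%:F).
  apply/rowP => i; rewrite !mxE cE; apply: eq_bigr => j _.
  by rewrite !mxE tofracM mulrC.
apply/eqP => /rowP g0.
have {}g0 i : g i = 0.
  by have := g0 i; rewrite !mxE -tofrac0 => /tofrac_inj.
move: Ia0 a00; rewrite IE => -[d ->].
by rewrite big1 ?eqxx // => i _; rewrite g0 mulr0.
Qed.

(** Suppose j is in J but not in P, and z in J^-1.  For p in P, (zp) j = (zj) p
    is in P, so zp is in P.  Thus z stabilizes P and is in D, so that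
    J J^-1 is contained in J, although it contains 1. *)
Lemma prufer_noetherian_dim1 P :
  noetherian D -> prufer_domain D ->
  prime_ideal P -> P <> [set 0] -> maximal_ideal P.
Proof.
move=> noeD prD [cP prP] P0; split=> // J /proper_idealP[idJ J1] PJ.
have [idP _] := (proper_idealP P).1 cP.
have nzP : nonzero_ideal P by [].
apply/seteqP; split=> // j Jj; apply: contrapT => nPj; apply: J1.
have : inv_prod J 1.
  apply/invertible_inv_prod; apply: prD; split; first exact: noetherian_fg.
  apply: (_ : nonzero_ideal J).2; apply/nonzero_idealE; split=> //.
  by have /nonzero_idealE[_ [a Pa a0]] := nzP; exists a => //; exact: PJ.
rewrite /inv_prod /= tofrac1 => J1.
apply/idealKE; rewrite tofrac1; move: J1; apply: mulK_ind.
- by rewrite -tofrac0; apply/idealKE; exact: ideal0.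
- move=> _ _ [a Ja <-] [b Jb <-]; rewrite -tofracD; apply/idealKE.
  exact: idealD.
move=> _ z [a Ja <-] Jz.
have /domKP[d ->] : domK z.
  apply: (stabilizer_integral noeD (prufer_integrally_closed prD) nzP).
  move=> p Pp; have /domKP[d dE] := Jz _ (PJ _ Pp).
  have /domKP[e eE] := Jz _ Jj.
  rewrite dE; apply/idealKE.
  have /orP[/set_mem //|/set_mem //] : (d \in P) || (j \in P).
  apply: prP; apply: mem_set; rewrite (_ : d * j = e * p); first exact: idealM.
  by apply: tofrac_inj; rewrite !tofracM -dE -eE mulrAC.
by rewrite -tofracM mulrC; apply/idealKE; exact: idealM.
Qed.

(** * Dedekind domains are Prüfer *)

(** An ideal maximal among the proper ideals containing J. *)
Lemma exists_prime_ideal J : noetherian D -> ideal J -> ~ J 1 ->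
  exists2 M, J `<=` M & prime_ideal M.
Proof.
move=> noeD idJ J1.
have [||M [[idM M1] JM] Mmax] :=
  @noetherian_maximal [set M | (ideal M /\ ~ M 1) /\ J `<=` M] J noeD.
- by move=> M [[]].
- by split.
have cM : idealr_closed [in M] by apply/proper_idealP.
exists M => //; split=> // x y /set_mem Mxy; apply/orP.
have [Mx|nMx] := pselect (M x).
  by left; exact: mem_set.
right; apply: mem_set.
pose N := [set n | exists d m, M m /\ n = d * x + m].
have NN : N 1.
  apply: contrapT => N1; apply: nMx; rewrite -(Mmax N) /=.
  - by exists 1, 0; rewrite mul1r addr0; split=> //; exact: ideal0.
  - split; [split=> //; apply/idealP; split|].
    + by exists 0, 0; rewrite mul0r addr0; split=> //; exact: ideal0.
    + move=> a _ _ [d [m [Mm ->]]] [d' [m' [Mm' ->]]].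
      exists (a * d + d'), (a * m + m'); split; last by ring.
      exact: idealMD.
    + by move=> m /JM Mm; exists 0, m; rewrite mul0r add0r.
  - by move=> m Mm; exists 0, m; rewrite mul0r add0r.
case: NN => d [m [Mm E]]; rewrite -[y]mul1r E.
rewrite (_ : _ * y = d * (x * y) + y * m); last by ring.
by apply: idealMD => //; exact: idealM.
Qed.

(** Let M be a prime ideal containing J and a a nonzero element of J.  Among
    the ideals (aD : b) contained in M, such as (aD : 1) = aD, a maximal one is
    prime; it contains a, so it is a maximal ideal and equal to M.  Then y = b/a
    maps M into D, but is not in D because 1 is not in (aD : b). *)
Lemma inv_proper_ideal J :
  dedekind_domain D -> nonzero_ideal J -> ~ J 1 ->
  exists2 y : K, ~ domK y & forall a, J a -> domK (y * a%:F).
Proof.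
move=> [noeD icD dimD] /nonzero_idealE[idJ [a Ja a0]] J1.
have [M JM prM] := exists_prime_ideal noeD idJ J1.
have [idM M1] := (proper_idealP M).1 prM.1.
pose colon b := [set d | exists c, d * b = c * a].
have colon_ideal b : ideal (colon b).
  apply/idealP; split; first by exists 0; rewrite !mul0r.
  move=> e x y [c xE] [d yE]; exists (e * c + d).
  by rewrite mulrDl -mulrA xE yE mulrDl mulrA.
have colonS b t : colon b `<=` colon (t * b).
  by move=> x [c xE]; exists (t * c); rewrite mulrCA xE mulrA.
have [||_ [[b ->] bM] bmax] := @noetherian_maximal
  [set I | (exists b, I = colon b) /\ I `<=` M] (colon 1) noeD.
- by move=> _ [[b ->] _]; exact: colon_ideal.
- split; first by exists 1.
  by move=> x [c]; rewrite mulr1 => ->; apply: idealM => //; exact: JM.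
have b1 : ~ colon b 1 by move=> /bM.
have colon_prime : prime_ideal (colon b).
  split; first by apply/proper_idealP.
  move=> x y /set_mem bxy; apply/orP.
  have [bx|nbx] := pselect (colon b x); first by left; exact: mem_set.
  right; apply: mem_set.
  (* Otherwise (aD : xb) and then (aD : tb) are strictly larger than (aD : b),
     hence not contained in M; this yields t, u outside M with ut in M. *)
  have [xM|/existsNP[t /not_implyP[xbt nMt]]] := pselect (colon (x * b) `<=` M).
    rewrite -(bmax (colon (x * b))) //; last by split=> //; exists (x * b).
    by case: bxy => c E; exists c; rewrite mulrA (mulrC y).
  exfalso; apply: nbx.
  have [tM|/existsNP[u /not_implyP[ubt nMu]]] := pselect (colon (t * b) `<=` M).
    rewrite -(bmax (colon (t * b))) //; last by split=> //; exists (t * b).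
    by case: xbt => c E; exists c; rewrite mulrCA.
  exfalso; have /orP[/set_mem //|/set_mem //] : (u \in M) || (t \in M).
  apply: prM.2; apply: mem_set; apply: bM.
  by case: ubt => c E; exists c; rewrite -mulrA.
have colon0 : colon b <> [set 0].
  apply: (_ : nonzero_ideal (colon b)).2; apply/nonzero_idealE; split=> //.
  by exists a => //; exists b; rewrite mulrC.
have [_ /(_ M prM.1 bM) Mb] := dimD _ colon_prime colon0.
have aF : a%:F != 0 by rewrite tofrac_eq0.
exists (b%:F / a%:F).
  move=> /domKP[c bE]; apply: b1; exists c; rewrite mul1r.
  by apply: tofrac_inj; rewrite tofracM -bE divfK.
move=> d /JM; rewrite Mb => -[c E]; apply/domKP; exists c.
by rewrite mulrAC -tofracM (mulrC b) E tofracM mulfK.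
Qed.

(** A nonzero element a of F turns F^-1 into the ideal aF^-1 of D, to which the
    determinant trick applies. *)
Lemma dedekind_prufer : dedekind_domain D -> prufer_domain D.
Proof.
move=> ddD F [[n [g FE]] F0]; have [noeD icD _] := ddD.
have : exists2 a, F a & a != 0.
  apply: contrapT => nF; apply: F0; apply/seteqP; split=> [a Fa|_ ->].
    by apply: contrapT => /eqP a0; apply: nF; exists a.
  by rewrite FE; exists (fun=> 0); rewrite big1 // => i _; rewrite mul0r.
move=> [a Fa a0]; have aF : a%:F != 0 by rewrite tofrac_eq0.
have ovD := overring_domK D.
apply/invertible_inv_prod; apply: contrapT => F1.
have inv1 : ideal_inv F 1 by move=> b _; rewrite mul1r; exists b.
have [||y nDy yF] := inv_proper_ideal ddD (J := inv_prod F) => //.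
  apply/nonzero_idealE; split; first exact: ideal_inv_prod.
  exists a => //; rewrite /inv_prod /= -[a%:F]mulr1.
  by apply: mulK_mem => //; exists a.
apply: nDy.
have yinv z : ideal_inv F z -> ideal_inv F (y * z).
  move=> Fz b Fb; have /domKP[d dE] := Fz b Fb.
  rewrite -mulrA dE; apply: yF; rewrite /inv_prod /= -dE mulrC.
  by apply: mulK_mem => //; exists b.
apply: (@stabilizer_integral [set d | ideal_inv F (d%:F / a%:F)]) => //.
  apply/nonzero_idealE; split; last by exists a => //=; rewrite divff.
  apply/idealP; split=> /= [|c d e Fd Fe].
    by move=> b _; rewrite tofrac0 !mul0r; exact: overring0.
  rewrite tofracD tofracM mulrDl -mulrA; apply: ideal_invD => //.
  exact: ideal_inv_scale.
move=> d /= Fd.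
have /domKP[e eE] := yinv _ Fd _ Fa.
rewrite mulrA divfK // in eE.
by exists e => //=; rewrite -eE -mulrA; exact: yinv.
Qed.

End BOperation.

Theorem proposition9 (D : idomainType) :
  (prufer_b_mult_domain D <-> prufer_domain D) /\
  [<-> b_noetherian D /\ prufer_domain D;
       b_dedekind_domain D;
       dedekind_domain D].
Proof.
split; first exact: prufer_b_mult_domainE.
tfae.
- by move=> [bnD prD]; split=> //; apply/prufer_b_mult_domainE.
- move=> [bnD /prufer_b_mult_domainE prD].
  have noeD := b_noetherian_prufer_noetherian bnD prD.
  split=> // [|P]; first exact: prufer_integrally_closed.
  exact: prufer_noetherian_dim1.
- move=> ddD; split; last exact: dedekind_prufer.
  by move=> I_ qI; case: ddD => noeD _ _; apply: noeD => n; case: (qI n) => -[].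
Qed.
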